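(* Let $(A,\mu,\alpha_A)$ be a Hom-associative algebra over $\mathbf{k}$ and $(M,\alpha_M)$ be an $A$-module with structure map $\rho \colon A \otimes M \to M$. For any integers $n,k \geq 0$, define the map \[ \rho^{n,k} = \alpha_M^{2^k-1} \circ \rho \circ (\alpha_A^n \otimes Id_M) \colon A \otimes M \to M. \] Then $\rho^{n,k}$ gives the Hom-module $M^k=(M,\alpha_M^{2^k})$ the structure of an $A^k$-module, where $A^k$ is the Hom-associative algebra $(A,\ \mu^{(k)} = \alpha_A^{2^k-1} \circ \mu,\ \alpha_A^{2^k})$.
   Context: $\mathbf{k}$ is a fixed associative and commutative ring of characteristic $0$; modules, tensor products and linear maps are over $\mathbf{k}$. For a self-map $\alpha$, $\alpha^n$ is the $n$-fold composition, $\alpha^0 = Id$. A Hom-associative algebra $(A,\mu,\alpha_A)$ is a $\mathbf{k}$-module $A$ with linear maps $\mu\colon A^{\otimes 2}\to A$, $\alpha_A\colon A\to A$ such that $\alpha_A\circ\mu=\mu\circ\alpha_A^{\otimes 2}$ and $\mu\circ(\alpha_A\otimes\mu)=\mu\circ(\mu\otimes\alpha_A)$. A Hom-module is a pair $(M,\alpha_M)$ of a $\mathbf{k}$-module $M$ and a linear self-map $\alpha_M\colon M\to M$. For a Hom-associative algebra $(A,\mu,\alpha_A)$, an $A$-module is a Hom-module $(M,\alpha_M)$ with a linear map $\rho\colon A\otimes M\to M$ (the structure map) such that $\alpha_M\circ\rho=\rho\circ(\alpha_A\otimes\alpha_M)$ (multiplicativity) and $\rho\circ(\alpha_A\otimes\rho)=\rho\circ(\mu\otimes\alpha_M)$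 (Hom-associativity). *)

(* Defs.v *)
From mathcomp Require Import all_boot all_algebra.

Set Implicit Arguments.
Unset Strict Implicit.
Unset Printing Implicit Defensive.

Import GRing.Theory.
Local Open Scope ring_scope.

(* [pchar R] only records a prime characteristic: for R = Z/4 it is empty.
   Characteristic 0 is therefore stated as injectivity of the map Z -> R. *)
Definition char_zero (R : comNzRingType) : Prop :=
  forall m : nat, m%:R = 0 :> R -> m = 0%N.

(* Throughout, a linear map U (x) V -> W is given by the corresponding bilinear
   map U -> V -> W, and an equality of linear maps out of a tensor product by
   the equality of the associated multilinear maps, i.e. on pure tensors. *)

Record is_hom_assoc_alg (R : comNzRingType) (A : lmodType R)
    (mu : A -> A -> A) (alpha : A -> A) : Prop := {
  hom_assoc_alg_mu_bilinear : bilinear_for *:%R *:%R mu;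
  hom_assoc_alg_alpha_linear : linear alpha;
  hom_assoc_alg_mult : forall x y, alpha (mu x y) = mu (alpha x) (alpha y);
  hom_assoc_alg_assoc : forall x y z,
    mu (alpha x) (mu y z) = mu (mu x y) (alpha z)
}.

Definition is_hom_module (R : comNzRingType) (M : lmodType R)
  (alphaM : M -> M) : Prop := linear alphaM.

Record is_module_over (R : comNzRingType) (A : lmodType R)
    (mu : A -> A -> A) (alphaA : A -> A) (M : lmodType R) (alphaM : M -> M)
    (rho : A -> M -> M) : Prop := {
  module_over_hom_module : is_hom_module alphaM;
  module_over_rho_bilinear : bilinear_for *:%R *:%R rho;
  module_over_mult : forall a m, alphaM (rho a m) = rho (alphaA a) (alphaM m);
  module_over_assoc : forall a b m,
    rho (alphaA a) (rho b m) = rho (mu a b) (alphaM m)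
}.

Definition twisted_mu (R : comNzRingType) (A : lmodType R)
    (mu : A -> A -> A) (alphaA : A -> A) (k : nat) : A -> A -> A :=
  fun a b => iter (2 ^ k - 1)%N alphaA (mu a b).

Definition twisted_alpha (R : comNzRingType) (V : lmodType R)
    (alpha : V -> V) (k : nat) : V -> V :=
  iter (2 ^ k)%N alpha.

Definition twisted_rho (R : comNzRingType) (A M : lmodType R)
    (alphaA : A -> A) (alphaM : M -> M) (rho : A -> M -> M) (n k : nat) :
    A -> M -> M :=
  fun a m => iter (2 ^ k - 1)%N alphaM (rho (iter n alphaA a) m).

(* Main.v *)
Require Import Defs.
From mathcomp Require Import all_boot all_algebra.

(** The exponents [2 ^ k] and [2 ^ k - 1] enter only through the fact that they
    are of the form [p.+1] and [p], so the theorem is one twisting construction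
    for an arbitrary exponent [p]: replace the action by
    [alphaM^p (rho (alphaA^n a) m)], the product by [alphaA^p (mu a b)] and the
    structure maps by their [p.+1]-st powers.

    Multiplicativity lets powers of the structure maps pass through [rho] and
    [mu].  Pushing all of them onto the arguments, both sides of the twisted
    Hom-associativity law become [alphaM^p] of the two sides of the original
    law, evaluated at [alphaA^(n + p) a], [alphaA^(n + p) b] and [alphaM^p m]:
    the exponent [p.+1] provides exactly the one additional [alphaA] on [a] and
    [alphaM] on [m] that the original law needs ([iter_twist_module]).

    A Hom-associative algebra is the same thing as a Hom-associative product
    that is a module over itself ([regular_moduleP]), so the statement about
    the twisted algebra is the case [M = A], [rho = mu], [n = 0] of the
    statement about modules. *)

Section IteratedTwist.

Variable R : comNzRingType.

Lemma iter_linear (V : lmodType R) (f : V -> V) (n : nat) :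
  linear f -> linear (iter n f).
Proof. by move=> lin_f; elim: n => // n IHn c x y /=; rewrite IHn lin_f. Qed.

(** Stated for two different spaces so that it covers both the action and, with
    [V = W], the product. *)
Lemma iter_morph2 (V W : Type) (f : V -> V) (g : W -> W) (op : V -> W -> W)
    (n : nat) :
  (forall x y, g (op x y) = op (f x) (g y)) ->
  forall x y, iter n g (op x y) = op (iter n f x) (iter n g y).
Proof. by move=> morph_op x y; elim: n => //= n ->; rewrite morph_op. Qed.

Lemma bilinear_comp (U V W : lmodType R) (op : U -> V -> W) (f : U -> U)
    (g : W -> W) :
  bilinear_for *:%R *:%R op -> linear f -> linear g ->
  bilinear_for *:%R *:%R (fun x y => g (op (f x) y)).
Proof.
move=> [linl linr] lin_f lin_g; split=> [y c u v | x c u v].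
- by rewrite lin_f linl lin_g.
- by rewrite linr lin_g.
Qed.

(** The regular module: this is what reduces assertions about Hom-associative
    algebras to assertions about modules. *)
Lemma regular_moduleP (A : lmodType R) (mu : A -> A -> A) (alpha : A -> A) :
  is_hom_assoc_alg mu alpha <-> is_module_over mu alpha alpha mu.
Proof. by split=> -[*]; split. Qed.

Lemma iter_twist_module (A M : lmodType R) (mu : A -> A -> A)
    (alphaA : A -> A) (alphaM : M -> M) (rho : A -> M -> M) (n p : nat) :
  is_hom_assoc_alg mu alphaA -> is_module_over mu alphaA alphaM rho ->
  is_module_over (fun a b => iter p alphaA (mu a b)) (iter p.+1 alphaA)
    (iter p.+1 alphaM) (fun a m => iter p alphaM (rho (iter n alphaA a) m)).
Proof.
move=> [_ linA multA _] [linM bil_rho multM assocM].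
have iter_mu q := iter_morph2 _ _ alphaA alphaA mu q multA.
have iter_rho q := iter_morph2 _ _ alphaA alphaM rho q multM.
split.
- exact: iter_linear.
- by apply: bilinear_comp => //; apply: iter_linear.
- move=> a m.
  by rewrite -iterD addnC iterD iter_rho -!iterD addnC.
- move=> a b m; congr (iter p alphaM _).
  (* Isolate the single [alphaA] acting on [a] that the original law consumes. *)
  have -> : iter n alphaA (iter p.+1 alphaA a) =
            alphaA (iter n alphaA (iter p alphaA a)).
    by rewrite -[RHS]iterS -!iterD addnS addSn.
  rewrite iter_rho assocM !iter_mu -[iter p alphaA (iter n _ b)]iterD.
  by rewrite addnC iterD.
Qed.

End IteratedTwist.

Theorem corollary4p4 (R : comNzRingType) (char0 : char_zero R)
    (A : lmodType R) (mu : A -> A -> A) (alphaA : A -> A)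
    (hA : is_hom_assoc_alg mu alphaA)
    (M : lmodType R) (alphaM : M -> M) (rho : A -> M -> M)
    (hM : is_module_over mu alphaA alphaM rho)
    (n k : nat) :
  is_hom_assoc_alg (twisted_mu mu alphaA k) (twisted_alpha alphaA k) /\
  is_module_over (twisted_mu mu alphaA k) (twisted_alpha alphaA k)
    (twisted_alpha alphaM k) (twisted_rho alphaA alphaM rho n k).
Proof.
have exp2E : (2 ^ k)%N = (2 ^ k - 1).+1 by rewrite subn1 prednK ?expn_gt0.
rewrite /twisted_alpha exp2E; split; last exact: iter_twist_module.
apply/regular_moduleP.
by apply: (iter_twist_module _ _ _ _ _ _ _ 0) => //; apply/regular_moduleP.
Qed.
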